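(* Let $\varepsilon>0$ and $m\ge 0$ be real numbers with $0\le m\varepsilon\le 1$. Then $$\lim_{\substack{t\to+\infty\\ t\in\varepsilon\mathbb{Z}}}\ \sum_{x\in\varepsilon\mathbb{Z}} a_1(x,t,m,\varepsilon)^2=\frac{m\varepsilon}{2\sqrt{1+m^2\varepsilon^2}}.$$
   Context: Fix $\varepsilon>0$ (lattice step) and $m\ge 0$ (mass). Consider the lattice $\varepsilon\mathbb{Z}^2=\{(x,t): x/\varepsilon,\ t/\varepsilon\in\mathbb{Z}\}$. A checker path on $\varepsilon\mathbb{Z}^2$ is a finite sequence of points of $\varepsilon\mathbb{Z}^2$ such that the vector from each point (except the last) to the next equals either $(\varepsilon,\varepsilon)$ or $(-\varepsilon,\varepsilon)$. A turn of a path is a point of the path (not the first and not the last) such that the vectors from it to the next point and to the previous point are orthogonal; $\mathrm{turns}(s)$ denotes the number of turns of $s$. For $(x,t)\in\varepsilon\mathbb{Z}^2$ with $t>0$ define $$a(x,t,m,\varepsilon):=(1+m^2\varepsilon^2)^{(1-t/\varepsilon)/2}\, i \sum_s(-im\varepsilon)^{\mathrm{turns}(s)},$$ the sum over all checker paths $s$ on $\varepsilon\mathbb{Z}^2$ from $(0,0)$ to $(x,t)$ whose first step goes to $(\varepsilon,\varepsilon)$ (an empty sum is $0$, and $(-im\varepsilon)^0=1$). Let $a_1(x,t,m,\varepsilon)$ denote the real part of $a(x,t,m,\varepsilon)$. *)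

(* Defs.v *)
From HB Require Import structures.
From mathcomp Require Import all_boot all_order all_algebra.
From mathcomp Require Import all_classical all_reals all_analysis.
From mathcomp Require Import complex.
Set Implicit Arguments. Unset Strict Implicit. Unset Printing Implicit Defensive.
Import Order.TTheory GRing.Theory Num.Theory.
Import numFieldNormedType.Exports.
Local Open Scope classical_set_scope.
Local Open Scope ring_scope.

(* A checker path on eps Z^2 starting at (0,0) with n steps is encoded by its
   sequence of steps: true = (eps,eps), false = (-eps,eps).  Its points are
   (eps * (partial sum of +-1), eps * j), j = 0..n. *)

Definition endpoint (s : seq bool) : int :=
  \sum_(b <- s) (if b then 1 else -1).

Definition turns (s : seq bool) : nat :=
  size [seq i <- iota 0 (size s).-1 | nth false s i != nth false s i.+1].

Section A.
Variable R : realType.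
Local Open Scope complex_scope.

(* a (k eps, n eps, m, eps), for k : int, n : nat (n >= 1 meaning t > 0):
   (1+m^2 eps^2)^((1 - n)/2) * i * sum over checker paths from (0,0) to
   (k eps, n eps) whose first step goes to (eps,eps) of (-i m eps)^turns. *)
Definition a (eps m : R) (k : int) (n : nat) : R[i] :=
  ((Num.sqrt (1 + m ^+ 2 * eps ^+ 2)) ^ (1 - n%:Z))%:C * 'i *
  \sum_(s : n.-tuple bool | (nth false s 0) && (endpoint s == k))
     (- 'i * (m * eps)%:C) ^+ turns s.

Definition a1 (eps m : R) (k : int) (n : nat) : R := complex.Re (a eps m k n).

Definition sumZ (f : int -> R) : R :=
  lim ((fun N : nat => \sum_(i < (2 * N).+1) f (i%:Z - N%:Z)) @ \oo).
End A.

(* Main.v *)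
Require Import Defs.
From HB Require Import structures.
From mathcomp Require Import all_boot all_order all_algebra.
From mathcomp Require Import all_classical all_reals all_analysis.
From mathcomp Require Import complex.
From mathcomp Require Import ring lra zify.
Set Implicit Arguments. Unset Strict Implicit. Unset Printing Implicit Defensive.
Import Order.TTheory GRing.Theory Num.Theory.
Import numFieldNormedType.Exports.
Local Open Scope classical_set_scope.
Local Open Scope ring_scope.

(* Write q = m eps, r = 1 + q^2. The transfer matrix of one step has determinant r
   and trace z + 1/z, so by Cayley-Hamilton the paths are counted by rescaled
   Chebyshev polynomials [cheb r n], and the real part of the amplitude at time
   n + 1 is q r^(-n/2) times a coefficient of [cheb r n]. These polynomials being
   palindromic, the sum of squares of the coefficients of [cheb r n] is the central
   coefficient of its square, and the Chebyshev form of the identity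
   sin((n+1)w)^2 - sin(nw)^2 = sin((2n+1)w) sin(w) turns the sum of a1^2 at time
   n + 2 into (q^2 / r) (P_0 + ... + P_n), where
   P_k = r^(-k) [X^k] cheb r (2 k + 1) is the Legendre polynomial P_k at
   x = (2 - r) / r = (1 - q^2) / (1 + q^2).
   The partial sums of the P_k converge: an energy argument gives P_k -> 0, and P_k
   differs by O(1/k^2) from the increment of a sequence tending to 0. Their limit L is nonnegative, and
   2 (1 - x) L^2 = 1: the generating function of the P_k is
   (1 - 2 x w + w^2)^(-1/2), so its square has an explicit expansion, whose iterated
   sums have Cesaro limit L^2 by Cesaro's theorem on products of series. *)

(** * Chebyshev polynomials and their central coefficients *)

(* With [X = z^2], [cheb r n] is [r^((n-1)/2) z^(n-1) U_(n-1)(y)], where [U] is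
   Chebyshev's polynomial of the second kind and [y = (z + 1/z) / (2 sqrt r)]. *)
Fixpoint cheb (K : comNzRingType) (r : K) (n : nat) : {poly K} :=
  if n is n'.+1 then
    if n' is n''.+1 then (1 + 'X) * cheb r n' - r%:P * 'X * cheb r n'' else 1
  else 0.

Arguments cheb : simpl never.

Lemma cheb0 (K : comNzRingType) (r : K) : cheb r 0 = 0.
Proof. by []. Qed.

Lemma cheb1 (K : comNzRingType) (r : K) : cheb r 1 = 1.
Proof. by []. Qed.

Lemma chebSS (K : comNzRingType) (r : K) (n : nat) :
  cheb r n.+2 = (1 + 'X) * cheb r n.+1 - r%:P * 'X * cheb r n.
Proof. by []. Qed.

Lemma nat_ind2 (P : nat -> Prop) :
  P 0%N -> P 1%N -> (forall n, P n -> P n.+1 -> P n.+2) -> forall n, P n.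
Proof.
move=> P0 P1 PSS n; suff: P n /\ P n.+1 by case.
by elim: n => [//|n [Pn Pn1]]; split=> //; apply: PSS.
Qed.

(** Addition formula sin((m+n+1)w) sin(w) = sin((m+1)w) sin((n+1)w) - sin(mw) sin(nw), where [cheb]
    rescales sin(nw) / sin(w). *)
Lemma chebD (K : comNzRingType) (r : K) (m n : nat) :
  cheb r (m + n).+1
  = cheb r m.+1 * cheb r n.+1 - r%:P * 'X * cheb r m * cheb r n.
Proof.
elim/nat_ind2: m n => [n|n|m IH0 IH1 n].
- by rewrite add0n cheb0 cheb1; ring.
- by rewrite add1n chebSS cheb1 chebSS cheb1 cheb0; ring.
by rewrite !addSn chebSS -addSn IH1 IH0 !chebSS; ring.
Qed.

Lemma size_cheb (K : comNzRingType) (r : K) (n : nat) : (size (cheb r n) <= n)%N.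
Proof.
elim/nat_ind2: n => [||n IH0 IH1]; first by rewrite cheb0 size_poly0.
  by rewrite cheb1 size_poly1.
apply/leq_sizeP => j ltnj; rewrite chebSS coefB mulrDl mul1r -mulrA coefD.
rewrite coefCM !coefXM; case: j ltnj => [//|j ltnj] /=.
move/leq_sizeP: (IH0) => /(_ j) ->; last by lia.
move/leq_sizeP: (IH1) => IH1'; rewrite !IH1'; first ring; lia.
Qed.

Lemma coef_cheb0 (K : comNzRingType) (r : K) (n j : nat) :
  (n <= j)%N -> (cheb r n)`_j = 0.
Proof. by move=> ltnj; apply: nth_default; apply: leq_trans (size_cheb _ _) _. Qed.

Lemma coef_chebSS (K : comNzRingType) (r : K) (n j : nat) :
  (cheb r n.+2)`_j.+1
  = (cheb r n.+1)`_j.+1 + (cheb r n.+1)`_j - r * (cheb r n)`_j.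
Proof.
by rewrite chebSS coefB mulrDl mul1r -mulrA coefD coefCM !coefXM.
Qed.

Lemma coef0_cheb (K : comNzRingType) (r : K) (n : nat) : (cheb r n.+1)`_0 = 1.
Proof.
elim: n => [|n IH]; first by rewrite cheb1 coef1.
by rewrite chebSS coefB mulrDl mul1r -mulrA coefD coefCM !coefXM /= IH; ring.
Qed.

(** The factors [1 + 'X] and [r%:P * 'X] of the recurrence are palindromic, and the end coefficients
    are both 1. *)
Lemma cheb_palindrome (K : comNzRingType) (r : K) (n i j : nat) :
  (i + j).+1 = n -> (cheb r n)`_i = (cheb r n)`_j.
Proof.
have coef_top m : (cheb r m.+1)`_m = 1.
  elim: m => [|m IH]; first by rewrite cheb1 coef1.
  by rewrite coef_chebSS IH !coef_cheb0 //; ring.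
elim/nat_ind2: n i j => [//|[|i] [|j]//|n IH0 IH1 i j].
case: i j => [|i] [|j] //.
- by rewrite add0n => -[->]; rewrite coef0_cheb coef_top.
- by rewrite addn0 => -[->]; rewrite coef0_cheb coef_top.
move=> [eqn]; rewrite !coef_chebSS (IH1 i.+1 j) ?(IH1 i j.+1) ?(IH0 i j); try lia.
ring.
Qed.

Lemma sum_coef_cheb_sqr (K : comNzRingType) (r : K) (n : nat) :
  \sum_(j < n) (cheb r n)`_j ^+ 2 = (cheb r n ^+ 2)`_n.-1.
Proof.
case: n => [|n]; first by rewrite big_ord0 cheb0 expr0n coef0.
rewrite expr2 coefM; apply: eq_bigr => i _; rewrite expr2; congr (_ * _).
by apply: cheb_palindrome; rewrite /= subnKC // -ltnS.
Qed.

Lemma coef_cheb_sqrS (K : comNzRingType) (r : K) (n : nat) :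
  (cheb r n.+1 ^+ 2)`_n = r * (cheb r n ^+ 2)`_n.-1 + (cheb r n.*2.+1)`_n.
Proof.
have -> : cheb r n.*2.+1 = cheb r n.+1 ^+ 2 - r%:P * (cheb r n ^+ 2 * 'X).
  by rewrite -addnn chebD; ring.
rewrite coefB coefCM coefMX.
by case: n => [|n] /=; rewrite ?cheb0 ?expr0n /= ?coef0; ring.
Qed.

(* [chebL] plays the role of [2 cos (n w)] when [cheb] is [sin (n w) / sin w]. *)
Definition chebL (K : comNzRingType) (r : K) (n : nat) : {poly K} :=
  2 * cheb r n.+1 - (1 + 'X) * cheb r n.

(** Chain rule for cos(nw): with X = z^2, the operator 2 X d/dX is z d/dz, and differentiating y =
    cos(w) brings out the factor X - 1. *)
Lemma chebL_deriv (K : comNzRingType) (r : K) (n : nat) :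
  2 * 'X * (chebL r n)^`() = n%:R * chebL r n + n%:R * ('X - 1) * cheb r n.
Proof.
have LSS m : chebL r m.+2 = (1 + 'X) * chebL r m.+1 - r%:P * 'X * chebL r m.
  by rewrite /chebL !chebSS; ring.
elim/nat_ind2: n => [||n IH0 IH1].
- have -> : chebL r 0 = 2%:P by rewrite /chebL cheb0 cheb1 rmorph_nat; ring.
  by rewrite derivC cheb0; ring.
- have -> : chebL r 1 = 1 + 'X by rewrite /chebL chebSS cheb0 cheb1; ring.
  rewrite derivD derivX derivC cheb1; ring.
rewrite LSS derivB !derivM derivD derivX !derivC.
have -> : 2 * 'X * ((0 + 1) * chebL r n.+1 + (1 + 'X) * (chebL r n.+1)^`()
    - ((0 * 'X + r%:P * 1) * chebL r n + r%:P * 'X * (chebL r n)^`()))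
  = 2 * 'X * chebL r n.+1 + (1 + 'X) * (2 * 'X * (chebL r n.+1)^`())
    - r%:P * 2 * 'X * chebL r n - r%:P * 'X * (2 * 'X * (chebL r n)^`()).
  by ring.
by rewrite IH0 IH1 /chebL !chebSS; ring.
Qed.

(** For odd [n], the operator 2 X d/dX - (n + 3) kills the monomial of degree (n + 3) / 2, so the
    left side has no such coefficient and the right side relates three central ones. *)
Lemma cheb_contiguous (K : comNzRingType) (r : K) (n : nat) :
  let F := ('X - 1) * chebL r n.+2 in
  2 * 'X * F^`() - n.+3%:R * F
  = n.+3%:R * cheb r n.+4 - n.+2%:R * (4 - 2 * r%:P) * 'X * cheb r n.+2
    + n.+1%:R * r%:P ^+ 2 * 'X ^+ 2 * cheb r n.
Proof.
move=> F; rewrite {}/F derivM derivB derivX derivC; set L := chebL r n.+2.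
have -> : 2 * 'X * ((1 - 0) * L + ('X - 1) * L^`())
  = 2 * 'X * L + ('X - 1) * (2 * 'X * L^`()).
  by ring.
rewrite chebL_deriv /L.
by rewrite /chebL !chebSS; ring.
Qed.

(* The [N]-th coefficient of [X F' - N F] vanishes, for
   [F = (X - 1) chebL r (2 N - 1)] as in [cheb_contiguous]. *)
Lemma cheb_central_rec (K : comNzRingType) (r : K) (N : nat) :
  N.*2.+4%:R * (cheb r N.*2.+4.+1)`_N.+2
  = N.*2.+3%:R * (4 - 2 * r) * (cheb r N.*2.+3)`_N.+1
    - N.*2.+2%:R * r ^+ 2 * (cheb r N.*2.+1)`_N.
Proof.
have := cheb_contiguous r N.*2.+1; move: (_ * chebL _ _) => F /=.
move: (cheb r N.*2.+4.+1) (cheb r N.*2.+3) (cheb r N.*2.+1) => A B D eqF.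
have {eqF} : 2%:P * (F^`() * 'X) - N.*2.+4%:R%:P * F
    = N.*2.+4%:R%:P * A - (N.*2.+3%:R * (4 - 2 * r))%:P * (B * 'X)
      + (N.*2.+2%:R * r ^+ 2)%:P * (D * 'X^2).
  rewrite !(rmorphM, rmorphB, rmorphXn, polyC_natr) /= in eqF *.
  apply: etrans (etrans _ eqF) _; first by ring.
  by ring.
move/(congr1 (fun p : {poly K} => p`_N.+2)).
rewrite !(coefD, coefN, coefCM, coefMX, coefMXn) /= coef_deriv.
rewrite !subSS subn0 -[F`_N.+2 *+ _]mulr_natl => eq0.
apply/eqP; rewrite -subr_eq0; apply/eqP.
have eq2 : N.*2.+4%:R = 2 * N.+2%:R :> K.
  by rewrite -!doubleS -muln2 natrM mulrC.
rewrite eq2 in eq0 *; rewrite mulrA subrr in eq0.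
by rewrite [RHS]eq0; ring.
Qed.

Lemma cheb_central1 (K : comNzRingType) (r : K) : (cheb r 3)`_1 = 2 - r.
Proof.
by rewrite !coef_chebSS !coef0_cheb cheb0 cheb1 coef0 coef1 /=; ring.
Qed.

(** * Generating polynomials of checker paths *)

Lemma turns_cons (b c : bool) (s : seq bool) :
  turns [:: b, c & s] = ((b != c) + turns (c :: s))%N.
Proof.
by rewrite /turns !size_filter /= (iotaDl 1 0) count_map.
Qed.

Lemma endpoint_count (s : seq bool) :
  endpoint s = 2 * (count id s)%:Z - (size s)%:Z.
Proof.
rewrite /endpoint; elim: s => [|b s IH]; first by rewrite big_nil.
by rewrite big_cons IH /=; case: b; lia.
Qed.

Lemma big_tuple_cons (V : nmodType) (T : finType) (n : nat)
    (F : n.+1.-tuple T -> V) :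
  \sum_s F s = \sum_b \sum_(t : n.-tuple T) F [tuple of b :: t].
Proof.
rewrite pair_big /=.
rewrite (reindex (fun p : T * n.-tuple T => [tuple of p.1 :: p.2])) //=.
exists (fun t => (thead t, behead_tuple t)) => [[b t] _|t _] /=.
  by congr (_, _); apply: val_inj.
by rewrite [RHS]tuple_eta; apply: val_inj.
Qed.

(* [X] marks the upward steps and [b] is the first step of the path, followed by
   [n] more. *)
Definition path_poly (K : comNzRingType) (z : K) (b : bool) (n : nat) : {poly K} :=
  \sum_(s : n.-tuple bool) z ^+ turns (b :: s) *: 'X^(count id (b :: s)).

Lemma path_polyS (K : comNzRingType) (z : K) (b : bool) (n : nat) :
  path_poly z b n.+1 = 'X^b * (path_poly z b n + z *: path_poly z (~~ b) n).
Proof.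
rewrite {1}/path_poly big_tuple_cons.
have E c : \sum_(t : n.-tuple bool) z ^+ turns [:: b, c & t]
    *: 'X^(count id [:: b, c & t]) = z ^+ (b != c) *: ('X^b * path_poly z c n).
  rewrite mulr_sumr scaler_sumr; apply: eq_bigr => t _.
  rewrite turns_cons [count _ _]/= !exprD -scalerA; congr (_ *: _).
  by rewrite -scalerAr.
rewrite big_bool mulrDr -scalerAr.
apply: (etrans (congr2 +%R (E true) (E false))).
by case: b {E} => /=; rewrite expr0 expr1 scale1r // addrC.
Qed.

(** By [path_polyS] a step acts on the pair by the matrix with rows (X, zX) and (z, 1), whose trace
    1 + X and determinant (1 - z^2) X are the coefficients in [chebSS]. *)
Lemma path_polyE (K : comNzRingType) (z : K) (n : nat) :
  let C := cheb (1 - z ^+ 2) in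
  path_poly z true n = 'X * (C n.+1 - C n) + z *: ('X * C n) /\
  path_poly z false n = C n.+1 - 'X * C n + z *: ('X * C n).
Proof.
elim: n => [|n /= [IHt IHf]].
  rewrite /path_poly /= !cheb0 !cheb1.
  have sum0 (F : 0.-tuple bool -> {poly K}) : \sum_s F s = F [tuple].
    by apply: big_pred1 => s /=; rewrite (tuple0 s); apply/esym/eqP.
  by rewrite !sum0 /turns /=; split; rewrite -!mul_polyC expr0; ring.
rewrite /= !path_polyS /= IHt IHf !chebSS -!mul_polyC.
have -> : (1 - z ^+ 2)%:P = 1 - z%:P ^+ 2 by rewrite polyCB polyC_exp.
by split; ring.
Qed.

Lemma coef_path_poly (K : comNzRingType) (z : K) (b : bool) (n j : nat) :
  (path_poly z b n)`_j
  = \sum_(s : n.-tuple bool | endpoint (b :: s) == 2 * j%:Z - n.+1%:Z)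
      z ^+ turns (b :: s).
Proof.
rewrite coef_sum [RHS]big_mkcond; apply: eq_bigr => s _.
rewrite coefZ coefXn endpoint_count [size _]/= size_tuple.
have -> : (2 * (count id (b :: s))%:Z - n.+1%:Z == 2 * j%:Z - n.+1%:Z)
  = (j == count id (b :: s)) by apply/eqP/eqP => ?; lia.
by case: eqP => _; rewrite ?mulr1 ?mulr0.
Qed.

Lemma big_tuple_nth0 (V : nmodType) (n : nat) (P : pred (seq bool))
    (F : seq bool -> V) :
  \sum_(s : n.+1.-tuple bool | nth false s 0 && P s) F s
  = \sum_(s : n.-tuple bool | P (true :: s)) F (true :: s).
Proof.
rewrite big_mkcond big_tuple_cons big_bool [RHS]big_mkcond -[RHS]addr0.
by congr (_ + _); apply: big1.
Qed.

(** * The real part of the amplitude and its sum of squares *)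

Lemma map_cheb (K L : comNzRingType) (f : {rmorphism K -> L}) (r : K) (n : nat) :
  map_poly f (cheb r n) = cheb (f r) n.
Proof.
elim/nat_ind2: n => [||n IH0 IH1]; rewrite ?cheb0 ?cheb1 ?rmorph0 ?rmorph1 //.
rewrite !chebSS rmorphB !rmorphM rmorphD rmorph1 /= map_polyX map_polyC.
by rewrite IH0 IH1.
Qed.

(** For z = -iq the polynomials [cheb] are real. In [path_polyE] the factor i makes the term without
    z imaginary, and i z = q makes the other one real. *)
Lemma a1_coef (R : realType) (eps m : R) (n j : nat) :
  let q := m * eps in
  a1 eps m (2 * j%:Z - n.+1%:Z) n.+1
  = Num.sqrt (1 + q ^+ 2) ^- n * q * ('X * cheb (1 + q ^+ 2) n)`_j.
Proof.
move=> q; rewrite /a1 /a -/q; set z := (- 'i * q%:C)%C.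
rewrite (big_tuple_nth0 _ (fun s => endpoint s == _) (fun s => z ^+ turns s)).
rewrite -coef_path_poly.
have z2 : 1 - z ^+ 2 = (1 + q ^+ 2)%:C%C.
  by apply/eqP; rewrite eq_complex /z /=; apply/andP; split; apply/eqP; ring.
have [-> _] := path_polyE z n.
rewrite z2 -!map_cheb -(map_polyX (real_complex R)) -rmorphB -!rmorphM.
rewrite coefD coefZ !coef_map /=.
have -> : 1 - n.+1%:Z = - n%:Z by lia.
by rewrite -exprMn -/q -exprnN; set c := _ ^- _; ring.
Qed.

Lemma a1_eq0 (R : realType) (eps m : R) (n : nat) (k : int) :
  a1 eps m k n.+1 != 0 -> exists j : 'I_n.+2, k = 2 * j%:Z - n.+1%:Z.
Proof.
move=> a1neq0.
have /existsP[s /eqP <-] : [exists s : n.-tuple bool, endpoint (true :: s) == k].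
  apply: contraNT a1neq0 => /existsPn nopath.
  rewrite /a1 /a; set z := (- 'i * _)%C.
  rewrite (big_tuple_nth0 _ (fun s => endpoint s == k) (fun s => z ^+ turns s)).
  by rewrite big1 ?mulr0 // => s; rewrite (negPf (nopath s)).
rewrite endpoint_count [size _]/= size_tuple.
have ltc : (count id (true :: s) < n.+2)%N.
  by rewrite ltnS (leq_trans (count_size _ _)) //= size_tuple.
by exists (Ordinal ltc).
Qed.

Lemma sumZ_finite (R : realType) (M : nat) (g : 'I_M -> int) (f : int -> R) :
  injective g -> (forall k, f k != 0 -> exists j, k = g j) ->
  sumZ f = \sum_j f (g j).
Proof.
move=> ginj fsupp; apply: lim_near_cst => //.
(* Beyond this bound the window [-N, N] contains every [g j]. *)
exists (\sum_j `|g j|)%N => // N /= leN.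
have fE k : f k = \sum_(j | k == g j) f (g j).
  case: (eqVneq (f k) 0) => [f0|/fsupp[j ->]].
    by rewrite big1 // => j /eqP <-.
  by rewrite (big_pred1 j) // => i; rewrite eq_sym (inj_eq ginj).
under eq_bigr do rewrite fE big_mkcond.
rewrite exchange_big /=; apply: eq_bigr => j _.
have lejN : (`|g j| <= N)%N.
  by apply: leq_trans leN; rewrite (bigD1 j) //= leq_addr.
have lti : (absz (g j + N%:Z)%R < (2 * N).+1)%N by lia.
rewrite -big_mkcond (big_pred1 (Ordinal lti)) // => i.
by apply/eqP/eqP => [eqi|->]; [apply: val_inj|]; rewrite /=; lia.
Qed.

Lemma sumZ_a1 (R : realType) (eps m : R) (n : nat) :
  let q := m * eps in let r := 1 + q ^+ 2 in
  sumZ (fun k => a1 eps m k n.+1 ^+ 2)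
  = q ^+ 2 * (r ^- n * (cheb r n ^+ 2)`_n.-1).
Proof.
move=> q r; rewrite (@sumZ_finite _ _ (fun j : 'I_n.+2 => 2 * j%:Z - n.+1%:Z)).
- rewrite -sum_coef_cheb_sqr !mulr_sumr big_ord_recl big_ord_recr /=.
  (* Both extreme endpoints contribute 0: index 0 by the factor X, index n + 1 by the degree of
     [cheb r n]. *)
  rewrite !a1_coef !coefXM /= coef_cheb0 // !mulr0 !expr0n /= add0r addr0.
  apply: eq_bigr => j _; rewrite a1_coef coefXM /= -/q -/r.
  rewrite !exprMn exprVn -exprM mulnC exprM sqr_sqrtr ?addr_ge0 ?sqr_ge0 //.
  by ring.
- by move=> i j /eqP eqij; apply/val_inj => /=; lia.
- by move=> k; rewrite expf_eq0 /= => /a1_eq0.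
Qed.

(** * Limits of real sequences *)

Lemma cvg0_le_norm (R : realType) (u v : nat -> R) :
  (forall n, `|u n| <= v n) -> v @ \oo --> (0 : R) -> u @ \oo --> (0 : R).
Proof.
move=> leuv v0; apply: (squeeze_cvgr (f := fun n => - v n) (h := v)) => //.
  by apply: nearW => n; rewrite -ler_norml.
by rewrite -[0 in X in _ --> X]oppr0; apply: cvgN.
Qed.

Lemma cvg0_harmonic (R : realType) (K : R) :
  (fun n => K / n.+1%:R) @ \oo --> (0 : R).
Proof.
by rewrite -(mulr0 K); apply: cvgM; [exact: cvg_cst | exact: cvg_harmonic].
Qed.

Lemma cvg0_sqr (R : realType) (u : nat -> R) :
  (fun n => u n ^+ 2) @ \oo --> (0 : R) -> u @ \oo --> (0 : R).
Proof.
move=> /cvgr0Pnorm_lt u0; apply/cvgr0Pnorm_lt => e e0.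
have e20 : 0 < e ^+ 2 by rewrite exprn_gt0.
near=> n; have : `|u n ^+ 2| < e ^+ 2 by near: n; exact: u0.
by rewrite normrX ltr_pXn2r ?nnegrE // ltW.
Unshelve. all: by end_near. Qed.

(** The bound telescopes: u n - K / (n + 1) is nondecreasing and stays below the nonincreasing u n +
    K / (n + 1). *)
Lemma cvgn_increment_bound (R : realType) (K : R) (u : nat -> R) :
  (forall n, `|u n.+1 - u n| <= K * (n.+1%:R^-1 - n.+2%:R^-1)) -> cvgn u.
Proof.
move=> leK; have K0 : 0 <= K.
  have := le_trans (normr_ge0 _) (leK 0%N).
  by rewrite pmulr_lge0 // subr_gt0 ltf_pV2 ?posrE // ltr_nat.
pose v n := u n - K / n.+1%:R; pose w n := u n + K / n.+1%:R.
have leuv n : v n <= v n.+1.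
    have := leK n; rewrite /v; move: n.+1%:R^-1 n.+2%:R^-1 => s t.
    by rewrite ler_norml => /andP[]; lra.
have lewu n : w n.+1 <= w n.
    have := leK n; rewrite /w; move: n.+1%:R^-1 n.+2%:R^-1 => s t.
    by rewrite ler_norml => /andP[]; lra.
have cv : cvgn v.
  apply: nondecreasing_is_cvgn; first exact/nondecreasing_seqP.
  exists (w 0%N) => _ [n _ <-]; apply: (@le_trans _ _ (w n)).
    by rewrite lerD2l ge0_cp // ?divr_ge0.
  by elim: n => [//|n IH]; apply: le_trans (lewu n) IH.
have -> : u = v \+ (fun n => K / n.+1%:R).
  by apply/funext => n; rewrite /= subrK.
by apply: is_cvgD => //; apply: cvgP; exact: cvg0_harmonic.
Qed.

(** Split [a] as (a - la) + la: the first part is at most a bound of [b] times the mean of |a - la|,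
    the second is la times the mean of [b]. *)
Lemma cvg_mean_conv (R : realType) (a b : nat -> R) (la lb : R) :
  a @ \oo --> la -> b @ \oo --> lb ->
  (fun n => n.+1%:R^-1 * \sum_(k < n.+1) a k * b (n - k)%N) @ \oo --> la * lb.
Proof.
move=> cva cvb.
have [M M0 leM] : exists2 M, 0 < M & forall n, `|b n| <= M.
  have /cvg_seq_bounded/pinfty_ex_gt0[M M0 leM] : cvgn b by exact: cvgP cvb.
  by exists M => // n; exact: leM.
pose X n := n.+1%:R^-1 * \sum_(k < n.+1) (a k - la) * b (n - k)%N.
have X0 : X @ \oo --> (0 : R).
  have dist0 : (fun n => `|a n - la|) @ \oo --> (0 : R).
    by apply/norm_cvg0P; rewrite subr_cvg0.
  apply: (@cvg0_le_norm _ _ (fun n => M * arithmetic_mean (fun n => `|a n - la|) n)).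
    move=> n; rewrite /X normrM ger0_norm ?invr_ge0 //= mulrCA ler_wpM2l ?invr_ge0 //.
    rewrite seriesEord /= mulr_sumr (le_trans (ler_norm_sum _ _ _)) //.
    by apply: ler_sum => k _; rewrite normrM mulrC ler_wpM2r.
  by rewrite -(mulr0 M); apply: cvgM; [exact: cvg_cst | exact: cesaro].
have -> : (fun n => n.+1%:R^-1 * \sum_(k < n.+1) a k * b (n - k)%N)
    = X \+ (fun n => la * arithmetic_mean b n).
  apply/funext => n; rewrite /X /arithmetic_mean /= seriesEord /= mulrCA -mulrDr.
  congr (_ * _).
  rewrite mulr_sumr [X in _ = _ + X](reindex_inj rev_ord_inj) -big_split /=.
  by apply: eq_bigr => k _; rewrite subSS; ring.
rewrite -[_ * _]add0r; apply: cvgD => //.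
by apply: cvgM; [exact: cvg_cst | exact: cesaro].
Qed.

(** * Decay and summability of Legendre sequences *)

(** Bonnet's recurrence, so that [p n] is P_n(x). *)
Definition legendre_rec (R : realType) (x : R) (p : nat -> R) : Prop :=
  [/\ p 0%N = 1, p 1%N = x & forall n,
    n.+2%:R * p n.+2 = n.*2.+3%:R * x * p n.+1 - n.+1%:R * p n].

(* The value [0] at [n = 0] makes [legendreS] and [legendre_diffS] hold there. *)
Definition legendre_diff (R : realType) (x : R) (p : nat -> R) (n : nat) : R :=
  if n is k.+1 then p k - x * p n else 0.

(** With [legendre_diffS], this makes the recurrence a first-order system in [p] and
    [legendre_diff], the latter being (1 - x^2) P_n'(x) / n for n > 0. *)
Lemma legendreS (R : realType) (x : R) (p : nat -> R) (n : nat) :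
  legendre_rec x p ->
  p n.+1 = x * p n - (1 - n.+1%:R^-1) * legendre_diff x p n.
Proof.
case=> p0 p1 prec; case: n => [|n] /=; first by rewrite p0 p1 mulr0; ring.
have n20 : n.+2%:R != 0 :> R by rewrite pnatr_eq0.
apply: (mulfI n20); rewrite prec.
have -> : n.*2.+3%:R = 2 * n.+2%:R - 1 :> R.
  by rewrite -muln2 -!natr1 natrM; ring.
have -> : n.+1%:R = n.+2%:R - 1 :> R by rewrite -[n.+2%:R]natr1 addrK.
by field.
Qed.

Lemma legendre_diffS (R : realType) (x : R) (p : nat -> R) (n : nat) :
  legendre_rec x p ->
  legendre_diff x p n.+1
  = (1 - x ^+ 2) * p n + x * (1 - n.+1%:R^-1) * legendre_diff x p n.
Proof. by move=> legp; rewrite /= (legendreS _ legp); ring. Qed.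

Lemma invS_bounds (R : realType) (n : nat) : 0 < (n.+1%:R^-1 : R) <= 1.
Proof. by rewrite invr_gt0 ltr0n invf_le1 ?ltr0n // ler1n. Qed.

(** Without the terms in 1 / (n + 1), a step of the system preserves this quadratic form; these
    terms only shrink [legendre_diff]. *)
Lemma legendre_energy_le1 (R : realType) (x : R) (p : nat -> R) (n : nat) :
  -1 < x < 1 -> legendre_rec x p ->
  legendre_diff x p n ^+ 2 + (1 - x ^+ 2) * p n ^+ 2 <= 1.
Proof.
move=> x1 legp; elim: n => [|n]; first by case: legp => /= -> _ _; nra.
rewrite (legendreS n legp) (legendre_diffS n legp).
have := invS_bounds R n; move: n.+1%:R^-1 => d dP.
move: (legendre_diff x p n) (p n) => a b le1.
have -> : ((1 - x ^+ 2) * b + x * (1 - d) * a) ^+ 2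
  + (1 - x ^+ 2) * (x * b - (1 - d) * a) ^+ 2
  = (1 - x ^+ 2) * b ^+ 2 + (1 - d) ^+ 2 * a ^+ 2 by ring.
apply: le_trans le1; rewrite addrC lerD2r ler_piMl ?sqr_ge0 //.
by rewrite expr_le1 //; lra.
Qed.

Lemma legendre_bounded (R : realType) (x : R) (p : nat -> R) :
  -1 < x < 1 -> legendre_rec x p ->
  exists B : R, forall n, [/\ `|p n| <= B, `|legendre_diff x p n| <= B,
    `|legendre_diff x p n * p n| <= B, `|legendre_diff x p n ^+ 2| <= B
    & `|p n ^+ 2| <= B].
Proof.
move=> x1 legp; have s0 : 0 < 1 - x ^+ 2 by nra.
pose B := (1 - x ^+ 2)^-1.
have BE : (1 - x ^+ 2) * B = 1 by rewrite mulfV // gt_eqF.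
have B1 : 1 <= B by rewrite invf_ge1 //; nra.
exists (B + 1) => n; have := legendre_energy_le1 n x1 legp.
move: (legendre_diff x p n) (p n) => a b leE.
have b2 : b ^+ 2 <= B.
  by rewrite -(ler_pM2l s0) BE; have := sqr_ge0 a; lra.
have a2 : a ^+ 2 <= B.
  apply: le_trans B1; apply: le_trans leE; rewrite lerDl.
  by apply: mulr_ge0; [exact: ltW | exact: sqr_ge0].
by split; rewrite ler_norml; apply/andP; split; nra.
Qed.

(** The increments of [F] tend to 0, hence so does F n / n by Cesaro. As [G] is bounded, the energy
    [E] tends to 0, and it controls both squares since 1 - x^2 > 0. *)
Lemma legendre_cvg0 (R : realType) (x : R) (p : nat -> R) :
  -1 < x < 1 -> legendre_rec x p ->
  p @ \oo --> (0 : R) /\ legendre_diff x p @ \oo --> (0 : R).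
Proof.
move=> x1 legp; have [B leB] := legendre_bounded x1 legp.
have s0 : 0 < 1 - x ^+ 2 by nra.
pose a := legendre_diff x p.
pose E n := a n ^+ 2 + (1 - x ^+ 2) * p n ^+ 2.
(* With this correction, [n E n + G n] has increments [O(1 / n)]. *)
pose G n := (1 - x ^+ 2) * p n ^+ 2 - x * (a n * p n).
pose F n := n%:R * E n + G n.
have FS n : F n.+1 - F n
    = n.+1%:R^-1 * (x * (a n * p n) - (1 - n.+1%:R^-1) * a n ^+ 2).
  rewrite /F /G /E {1 2 3}/a (legendreS n legp) (legendre_diffS n legp) -/a.
  have n0 : n.+1%:R != 0 :> R by rewrite pnatr_eq0.
  have -> : n%:R = n.+1%:R - 1 :> R by rewrite -natr1 addrK.
  by field.
have F0 : (fun n => (F n.+1 - F 0%N) / n.+1%:R) @ \oo --> (0 : R).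
  have -> : (fun n => (F n.+1 - F 0%N) / n.+1%:R)
      = arithmetic_mean (telescope F).
    by apply/funext => n; rewrite /arithmetic_mean /= telescopeK /= mulrC.
  apply: cesaro; apply: (@cvg0_le_norm _ _ (fun n => 2 * B / n.+1%:R)).
    move=> n; rewrite /telescope /= FS normrM mulrC.
    have dP := invS_bounds R n; rewrite [`|_^-1|]gtr0_norm; last by case/andP: dP.
    apply: ler_wpM2r; first by case/andP: dP => /ltW.
    have [_ _ B1 B2 _] := leB n; rewrite -/a in B1 B2.
    move: B1 B2 dP; move: n.+1%:R^-1 (a n * p n) (a n ^+ 2) => d u v B1 B2 dP.
    have x1n : `|x| <= 1 by rewrite ler_norml; lra.
    apply: le_trans (ler_normB _ _) _; rewrite !normrM.
    have -> : 2 * B = 1 * B + 1 * B by ring.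
    by apply: lerD; apply: ler_pM => //; rewrite ler_norml; lra.
  exact: cvg0_harmonic.
pose K := B * 2 + `|F 0%N|.
have E0 : E @ \oo --> (0 : R).
  rewrite -cvg_shiftS.
  have GB n : `|G n| <= B * 2.
    have [_ _ B1 _ B2] := leB n; rewrite -/a in B1.
    have x1n : `|x| <= 1 by rewrite ler_norml; lra.
    have x2n : `|1 - x ^+ 2| <= 1 by rewrite ler_norml; nra.
    rewrite /G; apply: le_trans (ler_normB _ _) _; rewrite !(normrM x) normrM.
    have -> : B * 2 = 1 * B + 1 * B by ring.
    by apply: lerD; apply: ler_pM.
  apply: (@cvg0_le_norm _ _
    (fun n => (F n.+1 - F 0%N) / n.+1%:R + K / n.+1%:R)) => [n /=|].
    rewrite -mulrDl ger0_norm; last first.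
      by rewrite /E addr_ge0 ?sqr_ge0 // mulr_ge0 ?sqr_ge0 // ltW.
    have FE : F n.+1 = n.+1%:R * E n.+1 + G n.+1 by [].
    rewrite ler_pdivlMr // FE mulrC.
    have := GB n.+1; have := ler_norm (F 0%N).
    by rewrite ler_norml /K => ? /andP[]; lra.
  by rewrite -[0 in X in _ --> X]addr0; apply: cvgD => //; exact: cvg0_harmonic.
split; apply: cvg0_sqr.
  apply: (@cvg0_le_norm _ _ (fun n => (1 - x ^+ 2)^-1 * E n)) => [n|].
    rewrite ger0_norm ?sqr_ge0 // ler_pdivlMl // /E lerDr.
    exact: sqr_ge0.
  by rewrite -(mulr0 (1 - x ^+ 2)^-1); apply: cvgM => //; exact: cvg_cst.
apply: (@cvg0_le_norm _ _ E) => // n.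
by rewrite ger0_norm ?sqr_ge0 // /E lerDl mulr_ge0 ?sqr_ge0 // ltW.
Qed.

Lemma cvg0_lin (R : realType) (k l : R) (u v : nat -> R) :
  u @ \oo --> (0 : R) -> v @ \oo --> (0 : R) ->
  (fun n => k * u n + l * v n) @ \oo --> (0 : R).
Proof.
move=> u0 v0; have := cvgD (cvgM (cvg_cst k) u0) (cvgM (cvg_cst l) v0).
by rewrite !mulr0 addr0 => cvuv; exact: cvuv.
Qed.

(* Two successive corrections, linear in [p] and [legendre_diff], leave
   increments [O(1 / n ^ 2)]. *)
Lemma legendre_series_cvg (R : realType) (x : R) (p : nat -> R) :
  -1 < x < 1 -> legendre_rec x p -> cvgn (series p).
Proof.
move=> x1 legp; have [B leB] := legendre_bounded x1 legp.
have [p0 a0] := legendre_cvg0 x1 legp.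
(* Without the terms in 1 / (n + 1), c a - p / 2 has increment [p n] and [L] has increment [a n].
   Those terms add - c a / (n + 1) to the first increment, which c L / (n + 1) absorbs up to O(1 /
   n^2). *)
pose a := legendre_diff x p; pose c := (2 * (1 - x))^-1.
pose L n := - 2^-1 * a n + - ((1 + x) / 2) * p n.
pose T n := 1 * (c * a n + - 2^-1 * p n) + c * (L n * n.+1%:R^-1).
have cvT : T @ \oo --> (0 : R).
  apply: cvg0_lin; first exact: cvg0_lin.
  rewrite -(mulr0 0); apply: cvgM; [exact: cvg0_lin | exact: cvg_harmonic].
pose W n := series p n - T n.
suff cvW : cvgn W.
  have -> : series p = W \+ T by apply/funext => n; rewrite /W /= subrK.
  by apply: is_cvgD => //; exact: cvgP cvT.
apply: (@cvgn_increment_bound _ (4 * c * B)) => n.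
have c0 : 0 < c by rewrite invr_gt0; lra.
have n1 : n.+1%:R != 0 :> R by rewrite pnatr_eq0.
have n2 : n.+2%:R != 0 :> R by rewrite pnatr_eq0.
have WS : W n.+1 - W n = (c * (a n * n.+2%:R / (2 * n.+1%:R) + L n.+1))
    * (n.+1%:R^-1 - n.+2%:R^-1).
  rewrite /W /series /= big_nat_recr //= /T /L -/(a n.+1) /a.
  rewrite (legendreS n legp) (legendre_diffS n legp) -/a /c.
  have n2' : n.+1%:R + 1 != 0 :> R by rewrite natr1.
  have -> : n.+2%:R = n.+1%:R + 1 :> R by rewrite natr1.
  have x1' : 1 - x != 0 by apply: lt0r_neq0; lra.
  move: n1 n2'; move: n.+1%:R => N N0 N10.
  by field; rewrite N0 N10 x1'.
rewrite WS normrM [X in _ * X]ger0_norm; last first.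
  by rewrite subr_ge0 lef_pV2 ?posrE // ler_nat.
apply: ler_wpM2r; first by rewrite subr_ge0 lef_pV2 ?posrE // ler_nat.
have leB1 : `|a n * n.+2%:R / (2 * n.+1%:R)| <= B.
  have [_ Ba _ _ _] := leB n; rewrite -mulrA normrM -[leRHS]mulr1.
  apply: ler_pM => //; rewrite ger0_norm // ler_pdivrMr ?mulr_gt0 //.
  by rewrite mul1r -natrM ler_nat; lia.
have leB2 : `|L n.+1| <= 2 * B.
  have [Bp Ba _ _ _] := leB n.+1; rewrite -/a in Ba.
  apply: le_trans (ler_normD _ _) _; rewrite !normrM.
  have -> : 2 * B = 1 * B + 1 * B by ring.
  by apply: lerD; apply: ler_pM => //; rewrite ler_norml; lra.
have -> : 4 * c * B = c * (4 * B) by ring.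
rewrite normrM (gtr0_norm c0) ler_pM2l //.
by apply: le_trans (ler_normD _ _) _; have := normr_ge0 (L n.+1); lra.
Qed.

(** * Convolutions and the value of the Legendre series *)

Definition convol (R : realType) (a b : nat -> R) (n : nat) : R :=
  \sum_(k < n.+1) a k * b (n - k)%N.

Lemma convolC (R : realType) (a b : nat -> R) (n : nat) :
  convol a b n = convol b a n.
Proof.
rewrite /convol (reindex_inj rev_ord_inj); apply: eq_bigr => k _ /=.
by rewrite subSS subKn 1?mulrC // -ltnS.
Qed.

Lemma convol_seriesS (R : realType) (a b : nat -> R) (n : nat) :
  let s k := series a k.+1 in
  convol s b n.+1 = convol s b n + convol a b n.+1.
Proof.
rewrite /= /convol big_ord_recl [X in _ = _ + X]big_ord_recl /=.
rewrite {1}/series /= big_nat1 addrCA -big_split /=; congr (_ + _).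
by apply: eq_bigr => k _; rewrite /series /= big_nat_recr //= mulrDl.
Qed.

(** The square of the generating function is 1 / (1 - 2 x w + w^2). *)
Lemma convol_legendre (R : realType) (x : R) (p : nat -> R) (n : nat) :
  legendre_rec x p ->
  convol p p n.+2 = 2 * x * convol p p n.+1 - convol p p n.
Proof.
case=> p0 p1 prec; pose g := \poly_(k < n.+3) p k.
have gE k : (k < n.+3)%N -> g`_k = p k by move=> ltk; rewrite coef_poly ltk.
have gg k : (k < n.+3)%N -> (g * g)`_k = convol p p k.
  move=> ltk; rewrite coefM; apply: eq_bigr => i _.
  by rewrite !gE //; have := ltn_ord i; lia.
(* [g] is a truncation of [(1 - 2 x X + X^2)^(-1/2)], hence satisfies its
   differential equation up to terms of high degree. *)
pose rho := g^`() - (2 * x)%:P * (g^`() * 'X) + g^`() * 'X^2 - x%:P * g + g * 'X.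
have rho0 k : (k < n.+2)%N -> rho`_k = 0.
  move=> ltk; rewrite /rho !(coefD, coefN, coefCM, coefMX, coefMXn) !coef_deriv.
  case: k ltk => [|[|k]] ltk; rewrite ?subSS ?subn0 /= !gE //; try lia.
  - by rewrite p0 p1; ring.
  - have := prec 0%N; rewrite double0 p0 p1 => eq2.
    by rewrite -[p 2 *+ 2]mulr_natl eq2; ring.
  have := prec k.+1; rewrite -![p _ *+ _]mulr_natl => ->.
  by rewrite doubleS -muln2 -!natr1 natrM; ring.
(* This coefficient of [g * rho], written through g^2, is (n + 2) / 2 times the wanted relation. *)
have := coefM g rho n.+1; rewrite big1 => [|i _]; last first.
  by rewrite rho0 ?mulr0 //; lia.
have -> : g * rho = 2^-1 *: ((g * g)^`() - (2 * x)%:P * ((g * g)^`() * 'X)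
    + (g * g)^`() * 'X^2 - (2 * x)%:P * (g * g) + 2%:P * (g * g * 'X)).
  apply: (@scalerI _ _ 2); rewrite ?pnatr_eq0 // scalerA mulfV ?pnatr_eq0 //.
  rewrite scale1r derivM /rho -mul_polyC polyCM polyC_natr.
  by ring.
move/eqP; rewrite coefZ mulf_eq0 invr_eq0 pnatr_eq0 /=.
rewrite !(coefD, coefN, coefCM, coefMX, coefMXn) !coef_deriv /=.
have -> : (if (n.+1 < 2)%N then 0
    else (g * g)`_(n.+1 - 2).+1 *+ (n.+1 - 2).+1) = convol p p n *+ n.
  case: ltnP => [lt2|ge2]; first by rewrite (_ : n = 0%N) ?mulr0n //; lia.
  by rewrite (_ : (n.+1 - 2).+1 = n) ?gg //; lia.
rewrite !gg -?[convol p p _ *+ _]mulr_natl; try lia; move=> /eqP eq0.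
have n20 : n.+2%:R != 0 :> R by rewrite pnatr_eq0.
apply: (mulfI n20); apply/eqP; rewrite -subr_eq0 -eq0; apply/eqP.
by rewrite -!natr1; ring.
Qed.

(** With H = 1 / (1 - 2 x w + w^2), the identity (1 - 2 x w + w^2) - (1 - w)^2 = (2 - 2 x) w gives
    (2 - 2 x) w H / (1 - w)^2 = 1 / (1 - w)^2 - H. *)
Lemma convol_series_legendre (R : realType) (x : R) (p : nat -> R) (n : nat) :
  legendre_rec x p ->
  let s k := series p k.+1 in
  (2 - 2 * x) * convol s s n = n.+2%:R - convol p p n.+1.
Proof.
move=> legp s; have [p0 p1 _] := legp.
have s0 : s 0%N = 1 by rewrite /s /series /= big_nat1.
have h0 : convol p p 0 = 1 by rewrite /convol big_ord1 p0 mulr1.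
have h1 : convol p p 1 = 2 * x.
  by rewrite /convol big_ord_recl big_ord1 /= p0 p1; ring.
have sp k : (2 - 2 * x) * convol s p k = 1 + convol p p k - convol p p k.+1.
  elim: k => [|k IH].
    by rewrite h0 h1 /convol big_ord1 s0 p0; ring.
  by rewrite convol_seriesS mulrDr IH (convol_legendre _ legp); ring.
elim: n => [|n IH].
  by rewrite h1 /convol big_ord1 s0; ring.
rewrite convol_seriesS [convol p s _]convolC mulrDr IH sp -[n.+3%:R]natr1.
by ring.
Qed.

Lemma legendre_series (R : realType) (x : R) (p : nat -> R) :
  -1 < x < 1 -> legendre_rec x p -> (forall n, 0 <= series p n) ->
  series p @ \oo --> (Num.sqrt (2 - 2 * x))^-1.
Proof.
move=> x1 legp s_ge0; have /cvg_ex[L cvL] := legendre_series_cvg x1 legp.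
have x2 : 0 < 2 - 2 * x by lra.
have [p0 _] := legendre_cvg0 x1 legp.
pose s k := series p k.+1.
have cvs : s @ \oo --> L by rewrite /s cvg_shiftS.
have L0 : 0 <= L.
  by rewrite -(cvg_lim _ cvL) //; apply: limr_ge; [exact: cvgP cvL | exact: nearW].
have := cvg_mean_conv p0 p0; rewrite mulr0 -cvg_shiftS => cvh.
have /(cvgM (cvg_cst (2 - 2 * x))) cvss := cvg_mean_conv cvs cvs.
have d0 : (fun n => n.+1%:R^-1 : R) @ \oo --> (0 : R) by exact: cvg_harmonic.
(* This is (n + 2) / (n + 1): the main term, and also the factor turning the mean of n + 2 terms in
   [cvh] into a division by n + 1. *)
have cvd : (fun n => 1 + n.+1%:R^-1 : R) @ \oo --> (1 + 0 : R).
  by apply: cvgD => //; exact: cvg_cst.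
have /cvgB/(_ (cvgM cvd cvh)) := cvd.
rewrite mulr0 subr0 addr0 => cv1.
have eqL : (2 - 2 * x) * (L * L) = 1.
  rewrite -(cvg_lim (@Rhausdorff R) cvss) -[RHS](cvg_lim (@Rhausdorff R) cv1).
  apply: (congr1 (fun F : nat -> R => lim (F @ \oo))); apply/funext => n /=.
  have n1 : n.+1%:R != 0 :> R by rewrite pnatr_eq0.
  have n2 : n.+1%:R + 1 != 0 :> R by rewrite natr1 pnatr_eq0.
  have := convol_series_legendre n legp; rewrite /= -/s => eqs.
  rewrite !fctE /= -/(convol s s n) -/(convol p p n.+1) mulrCA eqs.
  rewrite -![n.+2%:R]natr1; move: n1 n2; move: n.+1%:R (convol _ _ _) => N h N0 N10.
  by field; rewrite N0 N10.
have LN : L != 0 by apply: contraTneq isT => L00; move: eqL; rewrite L00; lra.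
have -> : (Num.sqrt (2 - 2 * x))^-1 = L; last exact: cvL.
have -> : 2 - 2 * x = L^-1 ^+ 2.
  by apply: (mulIf (mulf_neq0 LN LN)); rewrite eqL -expr2 -exprMn mulVf ?expr1n.
by rewrite sqrtr_sqr ger0_norm ?invr_ge0 // invrK.
Qed.

(** * The Legendre values behind the sum of squares, and its limit *)

(** Bonnet's recurrence is [cheb_central_rec] divided by 2 r^(n+2). *)
Lemma legendre_rec_cheb (R : realType) (r : R) : r != 0 ->
  legendre_rec ((2 - r) / r) (fun n => r ^- n * (cheb r n.*2.+1)`_n).
Proof.
move=> r0; split => [||n].
- by rewrite cheb1 coef1 expr0 invr1 mulr1.
- by rewrite cheb_central1 expr1 mulrC.
have := cheb_central_rec r n; rewrite !doubleS.
move: (cheb _ _)`_n.+2 (cheb _ _)`_n.+1 (cheb _ _)`_n => w v u.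
rewrite -muln2 -!natr1 natrM => rec.
have rn0 : r ^+ n != 0 by rewrite expf_neq0.
have {rec} -> : w = ((2 * n%:R + 3) * (4 - 2 * r) * v
    - (2 * n%:R + 2) * r ^+ 2 * u) / (2 * (n%:R + 2)).
  have n0 : 2 * (n%:R + 2) != 0 :> R by rewrite -natrD -natrM pnatr_eq0 addn2.
  by apply: (mulIf n0); rewrite mulfVK //; apply: (etrans (etrans _ rec)); ring.
rewrite !exprS; field; rewrite r0 rn0 -natrD addn2 pnatr_eq0 //.
Qed.

Lemma series_cheb (R : realType) (r : R) (n : nat) : r != 0 ->
  series (fun k => r ^- k * (cheb r k.*2.+1)`_k) n.+1
  = r ^- n * (cheb r n.+1 ^+ 2)`_n.
Proof.
move=> r0; elim: n => [|n IH].
  by rewrite /series /= big_nat1 cheb1 expr1n.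
rewrite -[series _ n.+2]/(\sum_(0 <= k < n.+2) _) big_nat_recr //=.
rewrite -[\sum_(0 <= k < n.+1) _]/(series _ n.+1) IH [in RHS]coef_cheb_sqrS mulrDr.
by congr (_ + _); rewrite (exprS r n) invfM mulrA (mulrC r^-1) mulfVK.
Qed.

Theorem theorem2 (R : realType) (eps m : R) :
  0 < eps -> 0 <= m -> 0 <= m * eps <= 1 ->
  (fun n : nat => sumZ (fun k : int => a1 eps m k n ^+ 2)) @ \oo -->
    (m * eps / (2 * Num.sqrt (1 + m ^+ 2 * eps ^+ 2)) : R).
Proof.
move=> _ _ /andP[q0 _]; rewrite -exprMn; set q := m * eps in q0 *.
set r := 1 + q ^+ 2; have r1 : 0 < r by rewrite ltr_wpDr ?sqr_ge0.
have rN : r != 0 by rewrite gt_eqF.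
pose p n := r ^- n * (cheb r n.*2.+1)`_n.
have sumE n : sumZ (fun k => a1 eps m k n.+2 ^+ 2) = q ^+ 2 / r * series p n.+1.
  by rewrite sumZ_a1 series_cheb // (exprS _ n) invfM -!mulrA.
rewrite -cvg_shiftS -cvg_shiftS /=.
have -> : (fun n => sumZ (fun k => a1 eps m k n.+2 ^+ 2))
    = (fun n => q ^+ 2 / r * series p n.+1) by apply/funext => n; exact: sumE.
(* For q = 0 one has x = 1, outside the range of [legendre_series], and both sides vanish. *)
have [q00|qN] := eqVneq q 0.
  rewrite q00 mul0r; under eq_fun do rewrite expr0n mul0r mul0r.
  exact: cvg_cst.
have qgt0 : 0 < q by rewrite lt_def qN.
have x1 : -1 < (2 - r) / r < 1.
  by rewrite ltr_pdivlMr // ltr_pdivrMr // /r; apply/andP; split; nra.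
have s_ge0 n : 0 <= series p n.
  case: n => [|n]; first by rewrite /series /= big_geq.
  rewrite series_cheb //; apply: mulr_ge0.
    by rewrite invr_ge0 exprn_ge0 // ltW.
  have <- := sum_coef_cheb_sqr r n.+1.
  by apply: sumr_ge0 => j _; exact: sqr_ge0.
have := legendre_series x1 (legendre_rec_cheb rN) s_ge0.
rewrite -cvg_shiftS => cvs.
have := cvgM (cvg_cst (q ^+ 2 / r)) cvs.
have sr0 : Num.sqrt r != 0 by rewrite sqrtr_eq0 -ltNge.
have rE : r = Num.sqrt r ^+ 2 by rewrite sqr_sqrtr // ltW.
(* Since 1 - x = 2 q^2 / r, the radicand is a perfect square. *)
have -> : 2 - 2 * ((2 - r) / r) = (2 * q / Num.sqrt r) ^+ 2.
  have -> : (2 * q / Num.sqrt r) ^+ 2 = 4 * q ^+ 2 / r.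
    by rewrite {2}rE; field.
  have -> : q ^+ 2 = r - 1 by rewrite /r; ring.
  by field.
rewrite sqrtr_sqr ger0_norm; last first.
  by apply: divr_ge0; [exact: mulr_ge0 | exact: sqrtr_ge0].
have -> : q ^+ 2 / r * (2 * q / Num.sqrt r)^-1 = q / (2 * Num.sqrt r).
  by rewrite {1}rE; field; rewrite qN sr0.
by move=> cv; exact: cv.
Qed.
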